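(* Let $V$ be a stochastic valuation and $P$ a probability assignment on $L$. Then $\check{\widehat V}=V$ (as stochastic valuations, i.e. they have the same finite-dimensional distributions) and $\widehat{\check P}=P$.
   Context: $B=\{B_j: j\in\mathbb N\}$ is a denumerable set of propositional symbols and $L$ is the set of propositional formulas generated from $B$ by $\neg$ and $\supset$ (other connectives are the usual abbreviations). A valuation $v:B\to\{0,1\}$ is identified with the subset $\{B_j: v(B_j)=1\}$ of $B$; $v\Vdash_c\alpha$ is classical satisfaction and $\vDash_c$ classical entailment. $B_\alpha$ is the set of symbols occurring in $\alpha$ and $[\![\alpha]\!]=\{v\cap B_\alpha : v\Vdash_c\alpha\}$. A probability assignment is a map $P$ from $L$ to the reals such that for all $\alpha,\beta\in L$: (P1) $0\le P(\alpha)\le1$; (P2) if $\vDash_c\alpha$ then $P(\alpha)=1$; (P3) if $\alpha\vDash_c\beta$ then $P(\alpha)\le P(\beta)$; (P4) if $\vDash_c\neg(\beta\wedge\alpha)$ then $P(\beta\vee\alpha)=P(\beta)+P(\alpha)$. A stochastic valuation $V$ is a family $\{V_{B_j}\}_{B_j\in B}$ of random variables on a probability space $(\Omega,\mathcal F,\mu)$, where $V_{B_j}$ takes values in $\{\emptyset,\{B_j\}\}$ ($\emptyset$ for false, $\{B_j\}$ for true). For finite non-empty $A\subseteq B$ and $U\subseteq A$, $\mathrm{Prob}(V_A=U)=\mu\big(\bigcap_{B_j\in A}V_{B_j}^{-1}(U\cap\{B_j\})\big)$. Two stochastic valuations are identified when all these finite-dimensional distributions coincide. For $\alpha\in L$,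 $\mathrm{Prob}_V(\alpha)=\sum_{U\in[\![\alpha]\!]}\mathrm{Prob}(V_{B_\alpha}=U)$. For a stochastic valuation $V$, $\widehat V$ is the map $\alpha\mapsto\mathrm{Prob}_V(\alpha)$ on $L$ (it is a probability assignment). For a probability assignment $P$, $\check P$ is the stochastic valuation, unique up to finite-dimensional distributions, such that $\mathrm{Prob}(\check P_A=U)=P(\phi_A^U)$ for every non-empty finite $A\subseteq B$ and $U\subseteq A$, where $\phi_A^U$ is the formula $\big(\bigwedge_{B_j\in U}B_j\big)\wedge\big(\bigwedge_{B_j\in A\setminus U}\neg B_j\big)$. *)

(* Defs.v *)
From HB Require Import structures.
From mathcomp Require Import all_boot all_order all_algebra finmap.
From mathcomp Require Import all_classical all_reals all_analysis.

Set Implicit Arguments.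
Unset Strict Implicit.
Unset Printing Implicit Defensive.

Import Order.TTheory GRing.Theory Num.Theory.
Local Open Scope classical_set_scope.
Local Open Scope fset_scope.
Local Open Scope ring_scope.

(** The propositional symbol [B_j] is represented by its index [j : nat], so
    finite sets of symbols are elements of [{fset nat}] and valuations are
    functions [nat -> bool]. *)
Inductive form : Type :=
| Sym of nat
| Neg of form
| Imp of form & form.

Definition And (a b : form) : form := Neg (Imp a (Neg b)).
Definition Or (a b : form) : form := Imp (Neg a) b.
Definition Top : form := Imp (Sym 0) (Sym 0).

Fixpoint sat (v : nat -> bool) (a : form) : bool :=
  match a with
  | Sym j => v j
  | Neg b => ~~ sat v b
  | Imp b c => sat v b ==> sat v c
  end.

Definition valid (a : form) : Prop := forall v, sat v a.
Definition entails (a b : form) : Prop := forall v, sat v a -> sat v b.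

Fixpoint symbols (a : form) : {fset nat} :=
  match a with
  | Sym j => [fset j]
  | Neg b => symbols b
  | Imp b c => symbols b `|` symbols c
  end.

(** [[a]] = { v ∩ B_a : v satisfies a } *)
Definition models (a : form) : set {fset nat} :=
  [set U | exists2 v, sat v a & U = [fset j in symbols a | v j]].

(** Conjunctions are iterated along the enumeration of the finite sets and
    closed by the tautology [Top], which is also the empty conjunction. *)
Definition phi (A U : {fset nat}) : form :=
  And (\big[And/Top]_(j <- U) Sym j)
      (\big[And/Top]_(j <- A `\` U) Neg (Sym j)).

Record prob_assignment (R : realType) := ProbAssignment {
  pa_fun :> form -> R;
  pa_itv : forall a, 0 <= pa_fun a <= 1;
  pa_valid : forall a, valid a -> pa_fun a = 1;
  pa_entails : forall a b, entails a b -> pa_fun a <= pa_fun b;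
  pa_add : forall a b, valid (Neg (And b a)) ->
    pa_fun (Or b a) = pa_fun b + pa_fun a }.

(** The values ∅ and {B_j} of the j-th random variable are encoded by [false]
    and [true]; [bool] carries the discrete sigma-algebra. *)
Record stochastic_valuation (R : realType) := StochasticValuation {
  sv_display : measure_display;
  sv_space : measurableType sv_display;
  sv_prob : probability sv_space R;
  sv_var : nat -> {RV sv_prob >-> bool} }.

(** Prob(V_A = U) *)
Definition fdd (R : realType) (V : stochastic_valuation R)
    (A U : {fset nat}) : R :=
  fine (sv_prob V (\bigcap_(j in [set` A]) (sv_var V j @^-1` [set j \in U]))).

Definition same_fdd (R : realType) (V W : stochastic_valuation R) : Prop :=
  forall A U : {fset nat}, A != fset0 -> U `<=` A -> fdd V A U = fdd W A U.

Definition Prob (R : realType) (V : stochastic_valuation R) (a : form) : R :=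
  \sum_(U \in models a) fdd V (symbols a) U.

Section Prob_is_probability_assignment.
Variables (R : realType) (V : stochastic_valuation R).

Lemma eq_sat (v w : nat -> bool) a : {in symbols a, v =1 w} -> sat v a = sat w a.
Proof.
elim: a => [j|b IHb|b IHb c IHc] /= vw; first by apply: vw; rewrite inE.
  by rewrite IHb.
by rewrite IHb ?IHc// => j js; apply: vw; rewrite inE js ?orbT.
Qed.

Let event (A U : {fset nat}) : set (sv_space V) :=
  \bigcap_(j in [set` A]) (sv_var V j @^-1` [set j \in U]).

Let measurable_event A U : measurable (event A U).
Proof.
apply: fin_bigcap_measurable => [|j _]; first exact: finite_fset.
rewrite -[X in measurable X]setTI.
exact: (measurable_funPT (sv_var V j)).
Qed.

Let sat_event (a : form) : set (sv_space V) :=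
  [set w | sat (fun j => sv_var V j w) a].

Let finite_models a : finite_set (models a).
Proof.
apply: (@sub_finite_set _ _ [set` fpowerset (symbols a)]); last exact: finite_fset.
move=> U [v _ ->] /=; rewrite fpowersetE; apply/fsubsetP => j.
by rewrite !inE /= => /andP[].
Qed.

Let sat_eventE a : sat_event a = (\bigcup_(U in models a) event (symbols a) U)%classic.
Proof.
apply/seteqP; split => [w wa|w [U [v va ->] wU]].
  exists [fset j in symbols a | sv_var V j w].
    by exists (fun j => sv_var V j w).
  by move=> j /= js; rewrite !inE /= js.
rewrite /sat_event /= (@eq_sat _ v)// => j js.
by have /= := wU j js; rewrite !inE /= js.
Qed.

Let measurable_sat_event a : measurable (sat_event a).
Proof. by rewrite sat_eventE; apply: fin_bigcup_measurable. Qed.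

Let trivIset_event a : trivIset (models a) (event (symbols a)).
Proof.
move=> U W [v _ Uv] [v' _ Wv'] [w [wU wW]]; apply/fsetP => j.
case: (boolP (j \in symbols a)) => js.
  by rewrite -(wU j js) -(wW j js).
by rewrite Uv Wv' !inE /= (negbTE js).
Qed.

Lemma ProbE a :
  Prob V a = fine (sv_prob V [set w | sat (fun j => sv_var V j w) a]).
Proof.
rewrite -/(sat_event a) sat_eventE measure_fin_bigcup// /Prob.
rewrite !fsbig_finite//= -sum_fine// => U _.
exact: fin_num_measure.
Qed.

Lemma Prob_itv a : 0 <= Prob V a <= 1.
Proof.
rewrite ProbE fine_ge0//= -lee_fin fineK ?probability_le1//.
  exact: measurable_sat_event.
exact/fin_num_measure/measurable_sat_event.
Qed.

Lemma Prob_valid a : valid a -> Prob V a = 1.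
Proof.
move=> va; rewrite ProbE (_ : [set w | _] = setT) ?probability_setT//.
by apply/seteqP; split => w //= _; exact: va.
Qed.

Lemma Prob_entails a b : entails a b -> Prob V a <= Prob V b.
Proof.
move=> ab; rewrite !ProbE fine_le//; try exact/fin_num_measure/measurable_sat_event.
by apply: le_measure; rewrite ?inE; [exact: measurable_sat_event..|move=> w /ab].
Qed.

Lemma Prob_add a b : valid (Neg (And b a)) ->
  Prob V (Or b a) = Prob V b + Prob V a.
Proof.
move=> ba; rewrite !ProbE -fineD; try exact/fin_num_measure/measurable_sat_event.
rewrite -measureU; try exact: measurable_sat_event.
  congr (fine (sv_prob V _)); apply/seteqP; split => w /=.
    by case: (sat _ b) => /=; [left|right].
  by case=> ->; rewrite ?implybT.
apply/seteqP; split => w //= -[wb wa].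
by have /= := ba (fun j => sv_var V j w); rewrite wa wb.
Qed.

End Prob_is_probability_assignment.

(** The probability assignment induced by a stochastic valuation. *)
Definition hat (R : realType) (V : stochastic_valuation R) : prob_assignment R :=
  ProbAssignment (Prob_itv V) (@Prob_valid R V) (@Prob_entails R V)
    (@Prob_add R V).

Definition realizes (R : realType) (P : prob_assignment R)
    (W : stochastic_valuation R) : Prop :=
  forall A U : {fset nat}, A != fset0 -> U `<=` A -> fdd W A U = P (phi A U).

(** Any two stochastic valuations realizing [P] have the same finite-dimensional
    distributions, so choosing one of them determines [check P] up to
    [same_fdd].  The existence of such a valuation is a Kolmogorov extension
    property that is not part of the definition; were it to fail, [check P]
    would be the junk value [all_false], which does not realize [P]. *)
Definition all_false (R : realType) : stochastic_valuation R :=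
  @StochasticValuation R _ unit (dirac tt) (fun=> cst false).

Definition check (R : realType) (P : prob_assignment R) :
    stochastic_valuation R :=
  if pselect (exists W, realizes P W) is left exW then sval (cid exW)
  else all_false R.

(* Main.v *)
Require Import Defs.
From HB Require Import structures.
From mathcomp Require Import all_boot all_order all_algebra finmap.
From mathcomp Require Import all_classical all_reals all_analysis.
From mathcomp Require Import lra.

(** A probability assignment is determined by its values on the minterms of
    [B_0, ..., B_(n-1)], since splitting a formula along enough symbols leaves
    pieces that are either equivalent to a minterm or unsatisfiable.  As
    [Prob V] agrees with the finite-dimensional distributions of [V] on the
    formulas [phi A U], everything reduces to the existence of a stochastic
    valuation realizing [P].  It is built on [0, 1] with the uniform
    probability: starting from [0, 1], every interval attached to a minterm [m]
    is cut into two consecutive intervals whose lengths are the values of [P]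
    at the two minterms extending [m], and the n-th variable of a point tells in
    which half it falls at the n-th step. *)

Set Implicit Arguments.
Unset Strict Implicit.
Unset Printing Implicit Defensive.

Import Order.TTheory GRing.Theory Num.Theory.
Local Open Scope classical_set_scope.
Local Open Scope fset_scope.
Local Open Scope ring_scope.

(** * Probability assignments and minterms *)

Section prob_assignment_theory.
Variables (R : realType) (P : prob_assignment R).

Lemma pa_equiv a b : (forall v, sat v a = sat v b) -> P a = P b.
Proof.
by move=> ab; apply/eqP; rewrite eq_le !pa_entails// => v; rewrite ab.
Qed.

Lemma pa_split a b : P a = P (And (Neg b) a) + P (And b a).
Proof.
rewrite -pa_add; last by move=> v /=; case: (sat v a); case: (sat v b).
by apply: pa_equiv => v /=; case: (sat v a); case: (sat v b).
Qed.

Lemma pa_unsat a : (forall v, ~~ sat v a) -> P a = 0.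
Proof.
(* Splitting [Top] along itself gives a contradictory piece and a piece equivalent to [Top], so the
   former has value 0. *)
move=> Na; have := pa_split Top Top.
have aE : P (And (Neg Top) Top) = P a.
  by apply: pa_equiv => v /=; rewrite (negbTE (Na v)); case: (v 0%N).
have TE : P (And Top Top) = P Top by apply: pa_equiv => v /=; case: (v 0%N).
by rewrite aE TE => /eqP; rewrite -subr_eq subrr => /eqP.
Qed.

End prob_assignment_theory.

Lemma prob_assignment_eq (R : realType) (P Q : prob_assignment R) :
  P =1 Q -> P = Q.
Proof.
case: P Q => [p p1 p2 p3 p4] [q q1 q2 q3 q4] /= /funext pq; subst q.
by congr ProbAssignment; exact: Prop_irrelevance.
Qed.

(** The truth values of [B_0, ..., B_(n-1)], most recent symbol first. *)
Fixpoint bits (v : nat -> bool) (n : nat) : seq bool :=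
  if n is m.+1 then v m :: bits v m else [::].

(** With the latest symbol at the head, refining a minterm by the next symbol is a mere cons. *)
Fixpoint minterm (s : seq bool) : Defs.form :=
  if s is b :: s' then
    And (if b then Sym (size s') else Neg (Sym (size s'))) (minterm s')
  else Top.

Lemma eq_bits v w n :
  (bits v n == bits w n) = all (fun j => v j == w j) (iota 0 n).
Proof.
elim: n => [|n IHn] //; rewrite -addn1 iotaD all_cat -IHn addn1 /= eqseq_cons.
by rewrite andbT andbC.
Qed.

Lemma sat_minterm v s : sat v (minterm s) = (bits v (size s) == s).
Proof.
elim: s => [|b s IHs] /=; first by case: (v 0%N).
by rewrite eqseq_cons -IHs; case: b => /=; case: (v (size s)) => /=;
  case: (sat v (minterm s)).
Qed.

Lemma symbols_bounded a : exists n, forall j, j \in symbols a -> (j < n)%N.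
Proof.
exists (\max_(j <- symbols a) j).+1 => j ja.
by rewrite ltnS (big_rem j)//= leq_maxl.
Qed.

Lemma prob_assignment_ext (R : realType) (P Q : prob_assignment R) :
  (forall s, P (minterm s) = Q (minterm s)) -> P = Q.
Proof.
move=> PQ; apply: prob_assignment_eq => a.
have [n an] := symbols_bounded a.
(* Here [k] counts the symbols below [n] that [minterm s] leaves undecided; at [k = 0] it decides
   every symbol of [a]. *)
suff H k s : (size s + k = n)%N ->
    P (And a (minterm s)) = Q (And a (minterm s)).
  have E v : sat v a = sat v (And a (minterm [::])).
    by rewrite /=; case: (sat v a); case: (v 0%N).
  by rewrite (pa_equiv P E) (pa_equiv Q E); exact: (H n).
elim: k s => [|k IHk] s sn.
  rewrite addn0 in sn.
  have [[v /andP[va /eqP vs]]|Nv] :=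
    pselect (exists v, sat v a && (bits v n == s)).
    have E w : sat w (And a (minterm s)) = sat w (minterm s).
      rewrite [LHS]/= negb_imply negbK.
      case: (boolP (sat w (minterm s))); rewrite ?andbF // sat_minterm sn -vs.
      rewrite eq_bits andbT => /allP wv.
      rewrite (@Defs.eq_sat w v)// => j /an jn.
      by apply/eqP/wv; rewrite mem_iota.
    by rewrite (pa_equiv P E) (pa_equiv Q E).
  have E w : ~~ sat w (And a (minterm s)).
    apply/negP => /=; rewrite negb_imply negbK sat_minterm sn => ws.
    by apply: Nv; exists w.
  by rewrite (pa_unsat P E) (pa_unsat Q E).
have E b v :
    sat v (And (if b then Sym (size s) else Neg (Sym (size s)))
      (And a (minterm s))) = sat v (And a (minterm (b :: s))).
  by case: b => /=; case: (sat v a); case: (v _); case: (sat v (minterm s)).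
rewrite (pa_split P _ (Sym (size s))) (pa_split Q _ (Sym (size s))).
rewrite !(pa_equiv _ (E true)) !(pa_equiv _ (E false)).
by congr (_ + _); apply: IHk; rewrite /= addSnnS.
Qed.

(** * Finite-dimensional distributions as probabilities of formulas *)

Lemma sat_bigAnd v (s : seq nat) (f : nat -> Defs.form) :
  sat v (\big[And/Top]_(j <- s) f j) = all (fun j => sat v (f j)) s.
Proof.
elim: s => [|j s IHs]; first by rewrite big_nil /=; case: (v 0%N).
by rewrite big_cons /= IHs negb_imply negbK.
Qed.

Lemma sat_phi v (A U : {fset nat}) : U `<=` A ->
  sat v (phi A U) <-> {in A, forall j, v j = (j \in U)}.
Proof.
move=> /fsubsetP UA; rewrite /= negb_imply negbK !sat_bigAnd.
split=> [/andP[/allP vU /allP vD] j jA|vA].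
  have [jU|jU] := boolP (j \in U); first exact: vU.
  by apply/negbTE/vD; rewrite inE jU.
apply/andP; split; apply/allP => j /=; first by move=> jU; rewrite vA// UA.
by rewrite inE => /andP[jU jA]; rewrite vA.
Qed.

Lemma fdd_Prob (R : realType) (V : stochastic_valuation R) (A U : {fset nat}) :
  U `<=` A -> fdd V A U = Prob V (phi A U).
Proof.
move=> UA; rewrite ProbE /fdd; congr (fine (sv_prob V _)).
by apply/seteqP; split => w; [move=> wA; apply/(sat_phi _ UA)|
  move=> /(sat_phi _ UA)] => // j; exact: wA.
Qed.

Lemma realizes_hat (R : realType) (P : prob_assignment R)
  (W : stochastic_valuation R) : realizes P W -> hat W = P.
Proof.
move=> PW; apply: prob_assignment_ext => s.
(* [realizes] only speaks of non-empty sets of symbols, so the empty minterm is treated apart. *)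
have [->|s0] := eqVneq s [::].
  by rewrite !pa_valid// => v /=; case: (v 0%N).
(* Excluded middle supplies a valuation [v] spelling [s]; without one, both sides would vanish. *)
have [[v /eqP vs]|Nv] := pselect (exists v, bits v (size s) == s); last first.
  by rewrite !pa_unsat// => v; apply/negP; rewrite sat_minterm => vs;
    apply: Nv; exists v.
pose A := [fset j in iota 0 (size s)].
pose U := [fset j in A | v j].
have UA : U `<=` A by exact: fset_sub.
have E w : sat w (minterm s) = sat w (phi A U).
  rewrite sat_minterm -[in eqbRHS]vs eq_bits; apply/idP/idP.
    move=> /allP wv; apply/(sat_phi w UA) => j; rewrite !inE /= => jA.
    by rewrite jA; apply/eqP/wv.
  move/(sat_phi w UA) => wv; apply/allP => j js.
  by rewrite wv ?inE//= js.
rewrite !(pa_equiv _ E) /= -fdd_Prob// PW//.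
apply/fset0Pn; exists 0%N; rewrite inE mem_iota.
by case: (s) s0.
Qed.

(** * Nested intervals with prescribed lengths *)

Section binary_process.
Local Open Scope classical_set_scope.
Local Open Scope ring_scope.
Variables (R : realType) (p : seq bool -> R).
Hypotheses (p_ge0 : forall s, 0 <= p s) (p_nil : p [::] = 1).
Hypothesis p_split : forall s, p s = p (false :: s) + p (true :: s).

(** The left endpoint of the interval attached to [s]. *)
Fixpoint lend (s : seq bool) : R :=
  if s is b :: s' then lend s' + (if b then p (false :: s') else 0) else 0.

Fixpoint code (w : R) (n : nat) : seq bool :=
  if n is m.+1 then (lend (true :: code w m) <= w) :: code w m else [::].

(** The domain is [measurableTypeR R] because [uniform_prob] lives on that
    measurable structure, and not on the canonical one of [R]. *)
Definition digit (n : nat) (w : measurableTypeR R) : bool :=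
  lend (true :: code w n) <= (w : R).

Lemma bits_digit w n : bits (digit^~ w) n = code w n.
Proof. by elim: n => //= n ->. Qed.

(** For each length the cells partition all of [R], so they need not be bounded. *)
Definition cell (s : seq bool) : set R := [set w | code w (size s) = s].

Lemma cell_cons b s :
  cell (b :: s) = cell s `&` [set w | (lend (true :: s) <= w) = b].
Proof.
apply/seteqP; split => w; rewrite /cell /=.
  by move=> [wb ws]; split => //; rewrite -wb ws.
by move=> [-> ->].
Qed.

Lemma measurable_cell s : measurable (cell s).
Proof.
elim: s => [|b s IHs].
  by rewrite (_ : cell _ = setT)//; apply/seteqP.
rewrite cell_cons; apply: measurableI => //; case: b.
  rewrite (_ : [set w | _] = `[lend (true :: s), +oo[%classic)//.
  by apply/seteqP; split => w /=; rewrite in_itv/= andbT.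
rewrite (_ : [set w | _] = `]-oo, lend (true :: s)[%classic)//.
by apply/seteqP; split => w /=; rewrite in_itv/= ltNge; [move=> ->|
  move=> /negPf].
Qed.

(** The event that the digit is true is a countable union of cells, one for each word of length
    [n]. *)
Lemma measurable_digit n : measurable_fun setT (digit n).
Proof.
apply: (@measurable_fun_bool _ _ _ _ true); rewrite setTI.
rewrite (_ : _ @^-1` _ = \bigcup_(s in [set s | size s = n]) cell (true :: s)).
  rewrite bigcup_mkcond; apply: countable_bigcupT_measurable => // s.
  by case: ifP => // _; exact: measurable_cell.
apply/seteqP; split => w /=.
  have sn : size (code w n) = n by elim: n => //= n ->.
  by rewrite /digit => wn; exists (code w n); rewrite /cell //= sn wn.
by move=> [s /= <-]; rewrite /cell /= => -[ws sw]; rewrite /digit.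
Qed.

HB.instance Definition _ n :=
  isMeasurableFun.Build _ _ _ _ (digit n) (measurable_digit n).

(** The cell of the point [1] may contain its right endpoint, hence the
    comparison of cells with open and closed instead of half-open intervals. *)
Lemma cell_subset s w : 0 <= w <= 1 -> cell s w -> lend s <= w <= lend s + p s.
Proof.
move=> w01; elim: s => [|b s IHs]; first by rewrite /= p_nil add0r.
rewrite cell_cons => -[/IHs /andP[ws sw]].
have := p_split s; case: b => /= ps wb; rewrite ?addr0.
  by rewrite wb/=; lra.
by rewrite ws /=; move/negbT: wb; rewrite -ltNge; lra.
Qed.

Lemma subset_cell s w :
  lend s < w < lend s + p s -> 0 <= w <= 1 /\ cell s w.
Proof.
elim: s => [|b s IHs]; first by rewrite /= p_nil add0r => /andP[/ltW-> /ltW->].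
rewrite cell_cons => wbs; have := p_split s.
(* Nonnegativity of both halves keeps each of them inside the interval of [s], where the induction
   hypothesis applies. *)
have := p_ge0 (false :: s); have := p_ge0 (true :: s) => p1 p0 ps.
have [|w01 ws] := IHs; first by case: b wbs => /=; lra.
split=> //; split=> //=; case: b wbs => /=; first by lra.
by rewrite addr0 => wbs; apply/negbTE; rewrite -ltNge; lra.
Qed.

(** Within [0, 1] the cell is squeezed between an open and a closed interval with the same
    endpoints, both of length [p s]. *)
Lemma uniform_prob_cell s : uniform_prob (@ltr01 R) (cell s) = (p s)%:E.
Proof.
have mcell : measurable (cell s `&` `[0, 1]%classic).
  by apply: measurableI; [exact: measurable_cell|].
have -> : uniform_prob (@ltr01 R) (cell s) =
    lebesgue_measure (cell s `&` `[0, 1]%classic).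
  rewrite /uniform_prob integral_uniform_pdf -[RHS]mul1e -integral_cst//.
  apply: eq_integral => w /[!inE] -[_]; rewrite /= in_itv /uniform_pdf /= => ->.
  by rewrite subr0 invr1.
have mu_itv b c : lebesgue_measure
    [set` Interval (BSide b (lend s)) (BSide c (lend s + p s))] = (p s)%:E.
  (* If [p s = 0] the endpoints coincide and the length formula takes its default value 0. *)
  rewrite lebesgue_measure_itv/= lte_fin ltrDl -EFinB addrC addKr.
  by case: ltgtP (p_ge0 s) => // <-.
apply/eqP; rewrite eq_le; apply/andP; split.
  rewrite -(mu_itv true false); apply: le_measure; rewrite ?inE//.
  by move=> w [ws] /=; rewrite !in_itv => w01; exact: cell_subset.
rewrite -(mu_itv false true); apply: le_measure; rewrite ?inE//.
by move=> w /=; rewrite !in_itv => /subset_cell[].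
Qed.

Definition binary_process : stochastic_valuation R :=
  @StochasticValuation R _ _ (uniform_prob (@ltr01 R)) (fun n => digit n).

Lemma Prob_binary_process s : Prob binary_process (minterm s) = p s.
Proof.
rewrite ProbE -[RHS]/(fine (p s)%:E) -uniform_prob_cell.
congr (fine (uniform_prob _ _)); apply/seteqP.
by split => w /=; rewrite sat_minterm bits_digit => /eqP.
Qed.

End binary_process.

(** * Existence of a realization and the two round trips *)

Lemma hat_surjective (R : realType) (P : prob_assignment R) :
  exists W, hat W = P.
Proof.
pose p s := P (minterm s).
have p_ge0 s : 0 <= p s by case/andP: (pa_itv P (minterm s)).
have p_nil : p [::] = 1 by apply: pa_valid => v /=; case: (v 0%N).
(* The split is along the symbol of index [size s]. *)
have p_split s : p s = p (false :: s) + p (true :: s) by exact: pa_split.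
exists (binary_process p); apply: prob_assignment_ext => s.
exact: Prob_binary_process.
Qed.

(** Surjectivity of [hat] rules out the junk branch of [check], since any [W] with [hat W = P]
    realizes [P]. *)
Lemma realizes_check (R : realType) (P : prob_assignment R) :
  realizes P (check P).
Proof.
rewrite /check; case: pselect => [exW|[]]; first by case: (cid exW).
have [W <-] := hat_surjective P.
by exists W => A U _; exact: fdd_Prob.
Qed.

Theorem theorem2p10 (R : realType) (V : stochastic_valuation R)
    (P : prob_assignment R) :
  same_fdd (check (hat V)) V /\ hat (check P) = P.
Proof.
split; last exact/realizes_hat/realizes_check.
by move=> A U A0 UA; rewrite realizes_check// fdd_Prob.
Qed.
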